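(* Let $q$ be a prime power and let $n$ be an integer with $n\geq 5$, or $n=4$ and $q\in\{2,3\}$. Let $\alpha\in\mathbb{F}_{q^n}^*$ and let $a,b\in\mathbb{F}_q$. Then there exist $x,y\in\mathbb{F}_{q^n}$ with $\mathrm{Tr}(x)=a$, $\mathrm{Tr}(y)=b$ and $\alpha=x\cdot y$.
   Context: $\mathrm{Tr}$ denotes the field trace $\mathrm{Tr}_{\mathbb{F}_{q^n}/\mathbb{F}_q}(x)=x+x^q+\cdots+x^{q^{n-1}}$. *)

(* Defs.v *)
From HB Require Import structures.
From mathcomp Require Import all_boot all_order all_algebra all_field.

Set Implicit Arguments.
Unset Strict Implicit.
Unset Printing Implicit Defensive.

Import GRing.Theory.
Local Open Scope ring_scope.

(* x + x^q + ... + x^(q^(n-1)), with q = #|F| and n = [L : F], as an element of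
   L; it lies in the image of F, so Tr(x) = a is expressed as Tr x = a%:A. *)
Definition Tr (F : finFieldType) (L : fieldExtType F) (x : L) : L :=
  \sum_(i < \dim {:L}) x ^+ (#|F| ^ i)%N.

(* Main.v *)
Require Import Defs.
From HB Require Import structures.
From mathcomp Require Import all_boot all_order all_fingroup all_algebra all_field.
From mathcomp Require Import zify ring.

Set Implicit Arguments.
Unset Strict Implicit.
Unset Printing Implicit Defensive.

Import GRing.Theory Num.Theory.
Local Open Scope ring_scope.

(* On L^*, the function
     (1 - (Tr x - a)^(q-1)) (1 - (Tr (alpha/x) - b)^(q-1))
   is the indicator of the solutions x.  Expanded, it is a combination of powers
   of x with exponents sum_i (c_i - d_i) q^i, where sum_i c_i, sum_i d_i <= q-1,
   and exponents only matter mod q^n - 1.  It suffices to find one exponent with a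
   nonzero coefficient.  Take u + v q - w q^2 - z q^3 with
   u + v = w + z = q-1, both parts as balanced as possible (for n = 4: v = 0,
   w = 1): then no other pair (c, d) gives this exponent, and the coefficient is
   +-C(q-1,u) C(q-1,w) alpha^(w q^2 + z q^3), which does not vanish because
   C(q-1,u) = (-1)^u in characteristic p. *)

(** * Carries in base [q] modulo [q ^ n - 1] *)

Definition pospart (x : int) : nat := if 0 <= x then `|x|%N else 0%N.

Variant pospart_spec (x : int) : nat -> Type :=
  | PosPart (y : nat) of x = y%:Z : pospart_spec x y
  | NegPart of x < 0 : pospart_spec x 0.

Lemma pospartP (x : int) : pospart_spec x (pospart x).
Proof.
rewrite /pospart; case: (lerP 0 x) => [x0|]; last by constructor.
by constructor; rewrite gez0_abs.
Qed.

(* A positive carry out of position [i] has to be paid for by [c i + d i]. *)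
Lemma carry_le1 (q n : nat) (k : nat -> int) (c d : nat -> nat) :
  (1 < q)%N -> (2 < n)%N -> k n = k 0%N ->
  (\sum_(i < n) c i < q)%N -> (\sum_(i < n) d i < q)%N ->
  (forall i, (i < n)%N -> q%:Z * k i.+1 - k i <= (c i)%:Z + (d i)%:Z) ->
  (\sum_(i < n) pospart (k i) <= 1)%N.
Proof.
move=> q1 n2 kn cq dq kcd.
have shift : (\sum_(i < n) pospart (k i.+1) = \sum_(i < n) pospart (k i))%N.
  case: n n2 kn {cq dq kcd} => // n _ kn.
  by rewrite big_ord_recr big_ord_recl /= kn addnC.
(* A positive carry that enters position [i] with no positive carry leaving it; keeping this slack
   makes the case of equality usable below. *)
pose drop i := if k i.+1 <= 0 then pospart (k i) else 0%N.
have step i : (i < n)%N ->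
    (q * pospart (k i.+1) + drop i <= c i + d i + pospart (k i))%N.
  move=> /kcd; rewrite /drop.
  by case: (pospartP (k i.+1)) => [y ->|y0]; case: (pospartP (k i)) => [z ->|z0];
    case: ifP; nia.
have : (\sum_(i < n) (q * pospart (k i.+1) + drop i) <=
        \sum_(i < n) (c i + d i + pospart (k i)))%N.
  by apply: leq_sum => i _; apply: step.
rewrite !big_split /= -big_distrr /= shift.
set K := (\sum_(i < n) pospart (k i))%N; set D := (\sum_(i < n) drop i)%N => le.
case: (leqP K 1) => // K1.
(* With [m = q - 1], the summed inequality reads [m * K + D <= m * 2], so [K > 1] leaves only
   equality. Since [D = 0], no positive carry ever dies: it runs round the whole cycle, which gives
   [K >= n > 2]. *)
have [K2 D0] : K = 2%N /\ D = 0%N.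
  move: le cq dq; move: (\sum_(i < n) c i)%N (\sum_(i < n) d i)%N => s t le sq tq.
  case: q q1 le sq tq {kcd step} => // m m0 le sq tq.
  have {le sq tq} le : (m * K + D <= m * 2)%N by lia.
  by case: (ltngtP K 2) => K2; nia.
have prop i : (i < n)%N -> 0 < k i -> 0 < k i.+1.
  move=> lin ki; move/eqP: D0; rewrite sum_nat_eq0 => /forallP/(_ (Ordinal lin)) /=.
  by rewrite /drop; case: ifP; case: (pospartP (k i)); lia.
have up i j : (i + j <= n)%N -> 0 < k i -> 0 < k (i + j)%N.
  elim: j => [|j IH] hij ki; first by rewrite addn0.
  by rewrite addnS; apply: prop; [lia | apply: IH; lia].
have k0 : 0 < k 0%N.
  have [/existsP[i ki]|/existsPn none] := boolP [exists i : 'I_n, 0 < k i].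
    by rewrite -kn -(subnKC (ltnW (ltn_ord i))); apply: up; rewrite ?subnKC // ltnW.
  suff : K = 0%N by lia.
  apply: big1 => i _; have := none i; case: (pospartP (k i)); lia.
suff : (n <= K)%N by lia.
rewrite -{1}(card_ord n) -sum1_card; apply: leq_sum => i _.
have := up 0%N i (ltnW (ltn_ord i)) k0; rewrite add0n; case: (pospartP (k i)); lia.
Qed.

Definition two_digits (i j u v k : nat) : nat := ((k == i) * u + (k == j) * v)%N.

Lemma sum_two_digits (n i j u v : nat) : (i < n)%N -> (j < n)%N ->
  (\sum_(k < n) two_digits i j u v k = u + v)%N.
Proof.
move=> hi hj.
have one l w : (l < n)%N -> (\sum_(k < n) (k == l :> nat) * w = w)%N.
  move=> hl; rewrite (bigD1 (Ordinal hl)) //= eqxx mul1n big1 ?addn0 // => k kl.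
  by rewrite -val_eqE /= in kl; rewrite (negbTE kl).
by rewrite big_split /= !one.
Qed.

(** Starting the partial sums [s] at [t] makes the carries cyclic: [s 0 = t] and [s n = t * q ^ n].
    By hypothesis [s j] also equals [t * q ^ n] minus the terms of index at least [j], so [q ^ j]
    divides it and the quotients serve as carries. *)
Lemma carries_of_dvd (q n : nat) (f : nat -> int) (t : int) : (0 < q)%N ->
  \sum_(i < n) f i * q%:Z ^+ i = t * (q%:Z ^+ n - 1) ->
  exists k : nat -> int, k n = k 0%N /\
    forall i, (i < n)%N -> f i = q%:Z * k i.+1 - k i.
Proof.
move=> q0 sumf.
pose s j : int := t + \sum_(i < j) f i * q%:Z ^+ i.
pose k j := (s j %/ q%:Z ^+ j)%Z.
have qn0 j : q%:Z ^+ j != 0 by rewrite expf_eq0 negb_and; lia.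
have tail j : (j <= n)%N -> s j = t * q%:Z ^+ n - \sum_(j <= i < n) f i * q%:Z ^+ i.
  move=> jn; rewrite /s.
  have := sumf; rewrite -!(big_mkord xpredT (fun i => f i * q%:Z ^+ i)).
  rewrite (big_cat_nat (leq0n j) jn) /= mulrBr mulr1 => sumE.
  by rewrite -[t * _](addrNK t) -sumE; ring.
have sE j : (j <= n)%N -> s j = k j * q%:Z ^+ j.
  move=> jn; rewrite /k divzK // tail //.
  apply: rpredB; first by apply: dvdz_mull; exact: dvdz_exp2l.
  rewrite big_nat; apply: rpred_sum => i /andP[ji _].
  by apply: dvdz_mull; exact: dvdz_exp2l.
exists k; split.
  have := sE n (leqnn n); rewrite tail // big_geq // subr0 => /(mulIf (qn0 n)) <-.
  by have := sE 0%N (leq0n n); rewrite /s big_ord0 addr0 expr0 mulr1.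
move=> i lin; apply: (mulIf (qn0 i)); rewrite mulrBl -sE 1?ltnW //.
rewrite [q%:Z * _]mulrC -mulrA -exprS -sE //.
by rewrite /s big_ord_recr /=; ring.
Qed.

Lemma congr_digits (q n : nat) (f g : nat -> nat) : (1 < q)%N -> (0 < n)%N ->
  (\sum_(i < n) f i * q ^ i = \sum_(i < n) g i * q ^ i %[mod (q ^ n).-1])%N ->
  exists k : nat -> int, k n = k 0%N /\
    forall i, (i < n)%N -> (f i)%:Z - (g i)%:Z = q%:Z * k i.+1 - k i.
Proof.
move=> q1 n0 /eqP fg.
have sumZ (h : nat -> nat) :
    (\sum_(i < n) h i * q ^ i)%N%:Z = \sum_(i < n) (h i)%:Z * q%:Z ^+ i.
  by rewrite (big_morph Posz PoszD (erefl 0)); apply: eq_bigr => i _; rewrite PoszM -rmorphXn.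
have [t ht] : exists t : int,
    (\sum_(i < n) f i * q ^ i)%N%:Z - (\sum_(i < n) g i * q ^ i)%N%:Z = t * (q%:Z ^+ n - 1).
  apply/dvdzP; have -> : q%:Z ^+ n - 1 = (q ^ n).-1%:Z.
    by rewrite -subn1 -subzn ?expn_gt0 ?(ltnW q1) // -rmorphXn.
  by rewrite -eqz_mod_dvd !modz_nat (eqP fg).
apply: (@carries_of_dvd q n (fun i => (f i)%:Z - (g i)%:Z) t); first lia.
rewrite -ht !sumZ -sumrB; apply: eq_bigr => i _; by rewrite mulrBl.
Qed.

(* The hypotheses allow no single carry [k i.+1 = 1] out of a negative digit
   (i = 2, 3), no single carry [-1] out of a positive one (i = 0, 1), and no
   pair of such carries.  For n = 4 the position after 3 is 0, whence the last
   disjunction. *)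
Lemma no_carry (q n u v w z : nat) (c d : nat -> nat) :
  (1 < q)%N -> (3 < n)%N -> (u + v).+1 = q -> (w + z).+1 = q ->
  (0 < u)%N -> (0 < w)%N -> (w <= u.+1)%N -> (w <= v.+1)%N -> (z <= v.+1)%N ->
  v = 0%N \/ (z <= u)%N /\ (4 < n)%N ->
  (\sum_(i < n) c i < q)%N -> (\sum_(i < n) d i < q)%N ->
  (\sum_(i < n) (c i + two_digits 2 3 w z i) * q ^ i =
   \sum_(i < n) (two_digits 0 1 u v i + d i) * q ^ i %[mod (q ^ n).-1])%N ->
  forall i, (i < n)%N -> (c i + two_digits 2 3 w z i = two_digits 0 1 u v i + d i)%N.
Proof.
move=> q1 n3 uv wz u0 w0 wu wv zv vzn cq dq cd.
have [k [kn /= kE]] := @congr_digits q n (fun i => c i + two_digits 2 3 w z i)%N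
  (fun i => two_digits 0 1 u v i + d i)%N q1 (ltnW (ltnW (ltnW n3))) cd.
have sum1 i j x y : (i < n)%N -> (j < n)%N -> (x + y).+1 = q ->
    (\sum_(l < n) two_digits i j x y l < q)%N.
  by move=> hi hj <-; rewrite sum_two_digits.
(* Dropping the subtracted digits from [kE] leaves the hypothesis of [carry_le1], once for [k] and
   once for [- k]. *)
have kp : (\sum_(i < n) pospart (k i) <= 1)%N.
  apply: (@carry_le1 q n k c (two_digits 2 3 w z)) => //; first lia.
    by apply: sum1 => //; lia.
  by move=> i lin; have := kE i lin; lia.
have km : (\sum_(i < n) pospart (- k i) <= 1)%N.
  apply: (@carry_le1 q n (fun i => - k i) d (two_digits 0 1 u v)) => //; [lia|lia| |].
    by apply: sum1 => //; lia.
  by move=> i lin; have := kE i lin; lia.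
have le1 (f : nat -> nat) i : (i < n)%N -> (f i <= \sum_(i < n) f i)%N.
  by move=> hi; rewrite (bigD1 (Ordinal hi)) //= leq_addr.
have le2 (f : nat -> nat) i j : (i < n)%N -> (j < n)%N -> i != j ->
    (f i + f j <= \sum_(i < n) f i)%N.
  move=> hi hj ij; rewrite (bigD1 (Ordinal hi)) //= (bigD1 (Ordinal hj)) /=; first lia.
  by rewrite -val_eqE /= eq_sym.
(* At [i = n - 1] the second position wraps round to 0 through [kn]. *)
have next (f : int -> nat) i : (i < n)%N -> (f (k i) + f (k i.+1)%N <= \sum_(i < n) f (k i))%N.
  move=> lin; case: (ltngtP i.+1 n) => [lt|gt|eq]; last 1 first.
  - by rewrite eq kn; apply: (le2 (fun i => f (k i))); lia.
  - by apply: (le2 (fun i => f (k i))); lia.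
  - lia.
(* At any other position only [c i] is added, and two adjacent carries cannot both be positive, so
   [c i < q] would have to pay for all of [q]. *)
have carry_pos i : (i < n)%N -> 0 < k i.+1 -> (i == 2%N) || (i == 3%N).
  move=> lin ki; have := kE i lin; have := leq_trans (next pospart i lin) kp.
  have := leq_ltn_trans (le1 c i lin) cq; rewrite /two_digits.
  case: (i =P 2%N) => // _; case: (i =P 3%N) => // _.
  by case: (pospartP (k i)); case: (pospartP (k i.+1)); nia.
have carry_neg i : (i < n)%N -> k i.+1 < 0 -> (i == 0%N) || (i == 1%N).
  move=> lin ki; have := kE i lin; have := leq_trans (next (fun x => pospart (- x)) i lin) km.
  have := leq_ltn_trans (le1 d i lin) dq; rewrite /two_digits.
  case: (i =P 0%N) => // _; case: (i =P 1%N) => // _.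
  by case: (pospartP (- k i)); case: (pospartP (- k i.+1)); nia.
have k12 : [/\ -1 <= k 1%N, k 1%N <= 0, -1 <= k 2%N, k 2%N <= 0 & -1 <= k 1%N + k 2%N].
  have p1 := carry_pos 0%N; have p2 := carry_pos 1%N.
  have := leq_trans (next (fun x => pospart (- x)) 1%N _) km.
  by case: (pospartP (- k 1%N)); case: (pospartP (- k 2%N)); split; lia.
have k34 : [/\ 0 <= k 3%N, k 3%N <= 1, 0 <= k 4%N, k 4%N <= 1 & k 3%N + k 4%N <= 1].
  have p1 := carry_neg 2%N; have p2 := carry_neg 3%N.
  have := leq_trans (next pospart 3%N _) kp.
  by case: (pospartP (k 3%N)); case: (pospartP (k 4%N)); split; lia.
have k5 i : (4 <= i)%N -> (i < n)%N -> k i.+1 = 0.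
  move=> i4 lin; case: (ltrgtP (k i.+1) (0 : int)) => // h.
    by case/orP: (carry_neg i lin h) => /eqP ii; rewrite ii in i4.
  by case/orP: (carry_pos i lin h) => /eqP ii; rewrite ii in i4.
have first4 (f : nat -> nat) : 
   (f 0 + f 1 + f 2 + f 3 + (if (4 < n)%N then f 4 else 0) <= \sum_(i < n) f i)%N.
  clear -n3; case: n n3 => [|[|[|[|[|n]]]]] // _.
    by rewrite !big_ord_recl big_ord0 /= !addn0 !addnA.
  by rewrite !big_ord_recl /= !addnA leq_addr.
have k0 : k 0%N = if (4 < n)%N then 0 else k 4%N.
  case: ifP => n4; last by rewrite -kn; congr k; lia.
  by rewrite -kn -(prednK (ltnW (ltnW (ltnW n3)))); apply: k5; lia.
have [z1 z2 z3 z4] : [/\ k 1%N = 0, k 2%N = 0, k 3%N = 0 & k 4%N = 0].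
  have e0 := kE 0%N; have e1 := kE 1%N; have e2 := kE 2%N; have e3 := kE 3%N; have e4 := kE 4%N.
  have k5' := k5 4%N.
  have := leq_ltn_trans (first4 c) cq; have := leq_ltn_trans (first4 d) dq.
  rewrite /two_digits /= in e0 e1 e2 e3 e4 *.
  case: k12 => ? ? ? ? ?; case: k34 => ? ? ? ? ?.
  have v1 : k 1%N = 0 \/ k 1%N = -1 by lia.
  have v2 : k 2%N = 0 \/ k 2%N = -1 by lia.
  have v3 : k 3%N = 0 \/ k 3%N = 1 by lia.
  have v4 : k 4%N = 0 \/ k 4%N = 1 by lia.
  (* For [n = 4] there is no position 4: its digits are replaced by 0, and the equation becomes the
     cyclic identity [k 0 = k 4]. Both cases of [n] then go through the same case analysis. *)
  have e4' : (if (4 < n)%N then c 4%N else 0%N)%:Z -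
      (if (4 < n)%N then d 4%N else 0%N)%:Z = k 0%N - k 4%N.
    by rewrite k0; case: ifP => n4; [have := e4 n4; rewrite k5' // | ]; lia.
  have n4 : (4 < n)%N -> k 0%N = 0 by rewrite k0 => ->.
  move: e4' (e0 (ltnW (ltnW (ltnW n3)))) (e1 (ltnW (ltnW n3))) (e2 (ltnW n3)) (e3 n3).
  move: (if (4 < n)%N then c 4%N else 0%N) (if (4 < n)%N then d 4%N else 0%N) => c4 d4.
  clear - q1 uv wz u0 w0 wu wv zv vzn v1 v2 v3 v4 n4.
  case: v1 v2 v3 v4 => -> [] -> [] -> [] ->; rewrite ?mulr0 ?mulr1 ?mulrN1 //; lia.
have kz i : (i < n)%N -> k i.+1 = 0.
  by case: i => [|[|[|[|i]]]] // lin; apply: k5.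
move=> i lin; have := kE i lin; rewrite kz // mulr0.
have -> : k i = 0.
  by case: i lin => [|i] lin; [rewrite k0 z4 if_same | rewrite kz // ltnW].
clear; lia.
Qed.

Lemma eq_two_digits (m n i j x y : nat) (f : nat -> nat) :
  (i < n)%N -> (j < n)%N -> (x + y = m)%N -> (\sum_(l < n) f l <= m)%N ->
  (forall l, (l < n)%N -> two_digits i j x y l <= f l)%N ->
  forall l, (l < n)%N -> f l = two_digits i j x y l.
Proof.
move=> hi hj xy fm le l ln; apply/eqP; rewrite eqn_leq le // andbT -subn_eq0.
have : (\sum_(l < n) (f l - two_digits i j x y l) + m <= m)%N.
  rewrite -{1}xy -(sum_two_digits x y hi hj) -big_split /=.
  by under eq_bigr do rewrite subnK ?le //.
rewrite -{2}[m]add0n leq_add2r leqn0 sum_nat_eq0 => /forallP /(_ (Ordinal ln)) /=.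
by [].
Qed.

(** Without carries the digits agree position by position. The two pairs of digits sit at disjoint
    positions, so [c] dominates the first and [d] the second; digit sums below [q] leave no room for
    more. *)
Lemma digits_unique (q n u v w z : nat) (c d : nat -> nat) :
  (1 < q)%N -> (3 < n)%N -> (u + v).+1 = q -> (w + z).+1 = q ->
  (0 < u)%N -> (0 < w)%N -> (w <= u.+1)%N -> (w <= v.+1)%N -> (z <= v.+1)%N ->
  v = 0%N \/ (z <= u)%N /\ (4 < n)%N ->
  (\sum_(i < n) c i < q)%N -> (\sum_(i < n) d i < q)%N ->
  (\sum_(i < n) (c i + two_digits 2 3 w z i) * q ^ i =
   \sum_(i < n) (two_digits 0 1 u v i + d i) * q ^ i %[mod (q ^ n).-1])%N ->
  forall i, (i < n)%N -> c i = two_digits 0 1 u v i /\ d i = two_digits 2 3 w z i.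
Proof.
move=> q1 n3 uv wz u0 w0 wu wv zv vzn cq dq cd.
have eq_cd := no_carry q1 n3 uv wz u0 w0 wu wv zv vzn cq dq cd.
have [n0 n1 n2] : [/\ 0 < n, 1 < n & 2 < n]%N by rewrite !(leq_trans _ n3).
move=> i lin; split.
  apply: (@eq_two_digits q.-1 n 0%N 1%N u v c) => // [||l /eq_cd];
    [clear -uv; lia|clear -uv cq; lia|].
  by clear; rewrite /two_digits; case: l => [|[|l]] /=; lia.
apply: (@eq_two_digits q.-1 n 2 3 w z d) => // [||l /eq_cd]; [clear -wz; lia|clear -wz dq; lia|].
by clear; rewrite /two_digits; case: l => [|[|[|[|l]]]] /=; lia.
Qed.

(** * Power sums over the nonzero elements *)

(** Orthogonality of characters: if some [y] has [y ^+ A != y ^+ B], multiplication by [y] permutes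
    the summands while scaling the sum by a factor other than 1. Otherwise all summands are 1, and
    there are [#|K| - 1] of them. *)
Lemma finField_sum_expr_div (K : finFieldType) (A B : nat) :
  \sum_(x : K | x != 0) x ^+ A / x ^+ B = - (A == B %[mod #|K|.-1])%:R.
Proof.
have K1 := finNzRing_gt1 K.
have cardU : #|[pred x : K | x != 0]| = #|K|.-1 by rewrite -[in RHS](cardC1 (0 : K)).
have unit_exp (x : K) : x != 0 -> x ^+ #|K|.-1 = 1.
  move=> x0; apply: (mulfI x0); rewrite -exprS prednK ?mulr1 ?expf_card //; exact: ltnW.
have exp_mod (x : K) m : x != 0 -> x ^+ m = x ^+ (m %% #|K|.-1).
  by move=> x0; rewrite {1}(divn_eq m #|K|.-1) exprD mulnC exprM unit_exp // expr1n mul1r.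
have [AB|AB] := boolP (A == B %[mod _]).
  rewrite (eq_bigr (fun=> 1)) => [|x x0]; last first.
    by rewrite exp_mod // (eqP AB) -exp_mod // divff // expf_eq0 negb_and x0 orbT.
  rewrite sumr_const cardU -subn1 natrB; last exact: ltnW.
  (* By Lagrange in the additive group, [#|K|] is zero in [K]. *)
  by rewrite -cardsT -[_%:R]FinRing.zmodXgE cyclic.expg_cardG ?inE // sub0r.
have [y y0 yAB] : exists2 y : K, y != 0 & y ^+ A != y ^+ B.
  apply/exists_inP; apply: contraNT AB; rewrite negb_exists_in => /forall_inP yAB.
  (* The residue of [A - B]. If it were nonzero, all [#|K| - 1] nonzero elements would be roots of
     unity of the smaller order [r]. *)
  pose r := ((A + (#|K|.-1 - B %% #|K|.-1)) %% #|K|.-1)%N.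
  have N0 : (0 < #|K|.-1)%N by rewrite -subn1 subn_gt0.
  have Br := ltn_pmod B N0.
  have [r0|r0] := posnP r.
    rewrite -(eqn_modDr (#|K|.-1 - B %% #|K|.-1)) -/r.
    by rewrite r0 -modnDml subnKC ?modnn // ltnW.
  have rN : (r < #|K|.-1)%N by rewrite ltn_mod.
  have : (size (enum [pred x : K | x != 0%R]) <= r)%N.
    apply: max_unity_roots (r0) _ (enum_uniq _); apply/allP => y; rewrite mem_enum => y0.
    apply/unity_rootP; rewrite -exp_mod // exprD (eqP (negbNE (yAB y y0))).
    by rewrite [y ^+ B]exp_mod // -exprD subnKC ?unit_exp // ltnW.
  by rewrite -cardE cardU leqNgt rN.
set S := \sum_(x | _) _; have : (y ^+ A / y ^+ B) * S = S.
  rewrite /S mulr_sumr [RHS](reindex_inj (mulfI y0)) /=.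
  apply: eq_big => x; first by rewrite mulf_eq0 negb_or y0.
  move=> x0; rewrite !exprMn invfM; ring.
move=> /eqP; rewrite -{2}[S]mul1r -subr_eq0 -mulrBl mulf_eq0 subr_eq0 => /orP[|/eqP ->];
  last by rewrite oppr0.
by rewrite -(inj_eq (mulIf (expf_neq0 B y0))) divfK ?expf_neq0 // mul1r (negbTE yAB).
Qed.

(** * Expansion of the trace indicator and its coefficients *)

(** The multinomial expansion is indexed by the choice of a term in each factor, so that its
    coefficients arise as numbers of maps with given fibre sizes. *)
Lemma expr_sum_fibers (R : comNzRingType) (m N : nat) (T : 'I_N -> R) :
  (\sum_k T k) ^+ m =
  \sum_(g : {ffun 'I_m -> 'I_N}) \prod_k T k ^+ #|[set r | g r == k]|.
Proof.
rewrite -{1}[m]card_ord -prodr_const bigA_distr_bigA; apply: eq_bigr => g _.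
rewrite (partition_big g xpredT) //=; apply: eq_bigr => k _.
rewrite -prodr_const; apply: eq_big => [r|r /eqP -> //].
by rewrite inE.
Qed.

Lemma sum_card_fibers (m N : nat) (g : 'I_m -> 'I_N) :
  (\sum_k #|[set r | g r == k]| = m)%N.
Proof.
rewrite -[RHS]card_ord -sum1_card (partition_big g xpredT) //=; apply: eq_bigr => k _.
by rewrite -sum1_card; apply: eq_bigl => r; rewrite inE.
Qed.

(** Such a map takes only the values [i] and [j], hence is determined by its fibre over [i], an
    arbitrary subset of size [u]. *)
Lemma card_two_fibers (m N u v : nat) (i j : 'I_N) : i != j -> (u + v = m)%N ->
  #|[set g : {ffun 'I_m -> 'I_N} |
      [forall k, #|[set r | g r == k]| == (k == i) * u + (k == j) * v]%N]|
   = 'C(m, u).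
Proof.
move=> ij uvm; rewrite -[m in RHS]card_ord -card_draws.
pose h (A : {set 'I_m}) : {ffun 'I_m -> 'I_N} := [ffun r => if r \in A then i else j].
have hA A : [set r | h A r == i] = A.
  by apply/setP => r; rewrite inE ffunE; case: ifP; rewrite ?eqxx // eq_sym (negbTE ij).
rewrite -(card_imset _ (can_inj (hA : cancel h (fun g => [set r | g r == i])))).
apply: eq_card => g; apply/idP/imsetP => [|[A]]; rewrite !inE => gA.
  exists [set r | g r == i]; first by rewrite inE (eqP (forallP gA i)) eqxx (negbTE ij) mul1n addn0.
  apply/ffunP => r; rewrite ffunE inE; case: eqP => // /eqP gi.
  apply/eqP; apply: contraT => gj.
  have := forallP gA (g r); rewrite (negbTE gi) (negbTE gj) cards_eq0 => /eqP/setP/(_ r).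
  by rewrite !inE eqxx.
move=> ->; apply/forallP => k; have [->|ki] := eqVneq k i.
  by rewrite hA (negbTE ij) (eqP gA) mul1n addn0.
have [->|kj] := eqVneq k j.
  rewrite mul1n add0n; have -> : [set r | h A r == j] = ~: A.
    by apply/setP => r; rewrite !inE ffunE; case: ifP; rewrite ?eqxx // (negbTE ij).
  by rewrite cardsCs setCK (eqP gA) card_ord -uvm addKn.
rewrite cards_eq0; apply/eqP/setP => r; rewrite !inE ffunE.
by case: ifP; rewrite eq_sym ?(negbTE ki) ?(negbTE kj).
Qed.

(** The identity [(1 + X) ^ q = 1 + X ^ q] kills the inner binomials ['C(q, j)]; Pascal's rule then
    makes ['C(q.-1, u)] alternate between 1 and -1. *)
Lemma bin_pred_neq0 (R : idomainType) (q u : nat) : (1 < q)%N -> [pchar R].-nat q -> (u < q)%N ->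
  'C(q.-1, u)%:R != 0 :> R.
Proof.
move=> q1 pq uq; have binq j : (0 < j < q)%N -> 'C(q, j)%:R = 0 :> R.
  move=> /andP[j0 jq]; have := congr1 (fun p : {poly R} => p`_j) (exprDn_pchar 1 'X (n := q) _).
  have pq' : [pchar {poly R}].-nat q by rewrite (eq_pnat _ (@pchar_poly R)).
  have := congr1 (fun p : {poly R} => p`_j) (exprDn_pchar 1 'X pq').
  rewrite exprDn coef_sum expr1n coefD coefXn coef1 (ltn_eqF jq) gtn_eqF // addr0.
  rewrite (bigD1 (Ordinal (ltnW (jq : (j < q)%N) : (j < q.+1)%N))) //= big1 ?addr0 => [|i ij].
    by rewrite expr1n mul1r coefMn coefXn eqxx.
  rewrite expr1n mul1r coefMn coefXn; case: eqP => [ji|]; last by rewrite mul0rn.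
  by case/negP: ij; apply/eqP/val_inj.
suff -> : 'C(q.-1, u)%:R = (-1) ^+ u :> R by rewrite signr_eq0.
elim: u uq => [|u IH] uq; first by rewrite bin0.
have := binq u.+1; rewrite uq -{1}(prednK (ltnW q1)) binS natrD => /(_ isT)/eqP.
by rewrite addr_eq0 IH 1?ltnW // exprS mulN1r => /eqP.
Qed.

(** Here [m] is [q - 1]. The constant [- a] is treated as one more term of the sum; when two digits
    already use up all [m] factors it is never chosen, so that coefficient does not depend on
    [a]. *)
Lemma trace_indicator (R : comNzRingType) (m n : nat) (a : R) : (0 < m)%N ->
  exists coef : {ffun 'I_n -> 'I_m.+1} -> R,
  (forall x : R, 1 - (\sum_(i < n) x ^+ (m.+1 ^ i) - a) ^+ m =
     \sum_(c : {ffun 'I_n -> 'I_m.+1} | (\sum_i c i <= m)%N)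
        coef c * x ^+ (\sum_i c i * m.+1 ^ i)) /\
  (forall (i j : 'I_n) (u v : nat) (c : {ffun 'I_n -> 'I_m.+1}),
     i != j -> (u + v = m)%N -> (forall k : 'I_n, c k = two_digits i j u v k :> nat) ->
     coef c = - 'C(m, u)%:R).
Proof.
move=> m0.
pose fib (g : {ffun 'I_m -> 'I_n.+1}) k := #|[set r | g r == k]|.
pose lo : 'I_n -> 'I_n.+1 := widen_ord (leqnSn n).
(* The fibre over [ord_max], which counts the choices of [- a], is left out. Fibres have size at
   most [m], so [inord] is exact. *)
pose dig g : {ffun 'I_n -> 'I_m.+1} := [ffun i => inord (fib g (lo i))].
have fib_sum g : (\sum_i fib g (lo i) + fib g ord_max = m)%N.
  by rewrite -[RHS](sum_card_fibers g) big_ord_recr.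
have digE g i : dig g i = fib g (lo i) :> nat.
  rewrite ffunE inordK // ltnS -(fib_sum g) (bigD1 i) //= -addnA; exact: leq_addr.
exists (fun c => (c == [ffun=> ord0])%:R - \sum_(g | dig g == c) (- a) ^+ fib g ord_max).
split=> [x|i j u v c ij uv cE].
  pose T (k : 'I_n.+1) : R := if (k < n)%N then x ^+ (m.+1 ^ k) else - a.
  have -> : \sum_(i < n) x ^+ (m.+1 ^ i) - a = \sum_k T k.
    rewrite big_ord_recr /= {2}/T ltnn; congr (_ - _).
    by apply: eq_bigr => i _; rewrite /T /= ltn_ord.
  rewrite expr_sum_fibers.
  under [RHS]eq_bigr do rewrite mulrBl.
  rewrite sumrB; congr (_ - _).
    rewrite (bigD1 [ffun=> ord0]) /=; last by rewrite big1 // => i _; rewrite ffunE.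
    rewrite eqxx mul1r big1 ?expr0 ?big1 ?addr0 // => [c /andP[_ /negbTE ->]|i _].
      by rewrite mul0r.
    by rewrite ffunE.
  rewrite (partition_big dig (fun c : {ffun 'I_n -> 'I_m.+1} => (\sum_i c i <= m)%N)) /=.
    apply: eq_bigr => c _; rewrite mulr_suml; apply: eq_bigr => g /eqP <-.
    rewrite big_ord_recr /= {2}/T ltnn -/(fib _ _) mulrC; congr (_ * _).
    rewrite -prodrXr; apply: eq_bigr => i _.
    by rewrite /T /= ltn_ord -exprM digE mulnC.
  move=> g _; under eq_bigr do rewrite digE.
  by rewrite -[X in (_ <= X)%N](fib_sum g) leq_addr.
have -> : c == [ffun=> ord0] = false.
  apply: contraTF m0 => /eqP c0; rewrite -leqNgt -uv -(sum_two_digits u v (ltn_ord i) (ltn_ord j)).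
  by rewrite leqn0 sum_nat_eq0; apply/forallP => k; rewrite -cE c0 ffunE.
rewrite sub0r -(card_two_fibers (N := n.+1) (i := lo i) (j := lo j) _ uv); last first.
  by rewrite -val_eqE /= val_eqE.
have fib_max g : dig g = c -> fib g ord_max = 0%N.
  move=> gc; apply: (@addnI m); rewrite addn0 -{2}(fib_sum g); congr (_ + _)%N.
  rewrite -uv -(sum_two_digits u v (ltn_ord i) (ltn_ord j)); apply: eq_bigr => k _.
  by rewrite -cE -gc digE.
have lo_max l : (ord_max == lo l) = false by rewrite -val_eqE /= gtn_eqF.
congr (- _); rewrite -sum1_card natr_sum; apply: eq_big => g; last by move=> /eqP/fib_max ->.
rewrite inE; apply/eqP/forallP => [gc k | gP].
  have [kn|kn] := ltnP k n.
    have -> : k = lo (Ordinal kn) by apply/val_inj.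
    by rewrite -/(fib g _) -digE gc cE.
  have -> : k = ord_max by apply/val_inj/eqP; rewrite eqn_leq kn -ltnS ltn_ord.
  by rewrite -/(fib g _) !lo_max (fib_max _ gc).
by apply/ffunP => l; apply/val_inj; rewrite /= digE cE; apply/eqP/(gP (lo l)).
Qed.

(** * Existence of elements with prescribed traces *)

Lemma trace_fixed (K : finFieldType) (q n : nat) (x : K) : [pchar K].-nat q -> #|K| = (q ^ n)%N ->
  (\sum_(i < n) x ^+ (q ^ i)) ^+ q = \sum_(i < n) x ^+ (q ^ i).
Proof.
move=> pq cardK; have q0 : (0 < q)%N by case/andP: pq.
rewrite (big_morph (fun y : K => y ^+ q) (fun y z => exprDn_pchar y z pq) (expr0n K q)).
rewrite (gtn_eqF q0).
case: n cardK => [|n] cardK; first by rewrite !big_ord0.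
rewrite big_ord_recr big_ord_recl /= -!exprM mulnC -expnS -cardK expf_card addrC expn0 expr1.
by congr (_ + _); apply: eq_bigr => i _; rewrite -exprM mulnC -expnS.
Qed.

Lemma expr_pred_fixed (K : fieldType) (q : nat) (t : K) : (0 < q)%N ->
  t ^+ q = t -> t != 0 -> t ^+ q.-1 = 1.
Proof.
by move=> q0 tq t0; apply: (mulfI t0); rewrite -exprS prednK // tq mulr1.
Qed.

(** Everything takes place in [K], with [a] and [b] given as Frobenius-fixed elements. The digits
    [u], [v], [w], [z] stay free so that one argument serves both [n = 4] and larger [n]. *)
Lemma inverse_traces (K : finFieldType) (m n u v w z : nat) (alpha a b : K) :
  [pchar K].-nat m.+1 -> #|K| = (m.+1 ^ n)%N ->
  (3 < n)%N -> (u + v)%N = m -> (w + z)%N = m ->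
  (0 < u)%N -> (0 < w)%N -> (w <= u.+1)%N -> (w <= v.+1)%N -> (z <= v.+1)%N ->
  v = 0%N \/ (z <= u)%N /\ (4 < n)%N ->
  alpha != 0 -> a ^+ m.+1 = a -> b ^+ m.+1 = b ->
  exists x : K, [/\ x != 0, \sum_(i < n) x ^+ (m.+1 ^ i) = a &
     \sum_(i < n) (alpha / x) ^+ (m.+1 ^ i) = b].
Proof.
move=> pq cardK n3 uv wz u0 w0 wu wv zv vzn alpha0 aq bq.
have m0 : (0 < m)%N by rewrite -uv addn_gt0 u0.
set q := m.+1 in pq cardK aq bq *.
pose tr (x : K) := \sum_(i < n) x ^+ (q ^ i).
have [/existsP[x /and3P[x0 /eqP xa /eqP xb]]|] :=
  boolP [exists x, [&& x != 0, tr x == a & tr (alpha / x) == b]]; first by exists x.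
rewrite negb_exists => /forallP none; exfalso.
(* Both [tr x] and [c] are fixed by Frobenius, so a nonzero difference has [m]-th power 1. *)
have zero_one c (x : K) : c ^+ q = c -> 1 - (tr x - c) ^+ m = (tr x == c)%:R.
  move=> cq; rewrite -[tr x == c]subr_eq0; case: eqP => [->|/eqP tc].
    by rewrite expr0n gtn_eqF // subr0.
  rewrite (_ : _ ^+ m = 1) ?subrr //; apply: (@expr_pred_fixed K q) => //.
  have := exprDn_pchar (tr x - c) c pq; rewrite subrK trace_fixed // cq => E.
  by apply: (addIr c); rewrite subrK; apply: esym.
have [ca [caE ca0]] := trace_indicator n a m0.
have [cb [cbE cb0]] := trace_indicator n b m0.
pose W (c : {ffun 'I_n -> 'I_q}) := (\sum_i c i * q ^ i)%N.
pose two i j s t : {ffun 'I_n -> 'I_q} := [ffun k : 'I_n => inord (two_digits i j s t k)].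
have twoE i j s t (k : 'I_n) : (i != j)%N -> (s + t)%N = m ->
    two i j s t k = two_digits i j s t k :> nat.
  move=> ij st; rewrite ffunE inordK // ltnS -st /two_digits.
  by case: eqP => [->|_]; case: eqP => //; lia.
pose c0 := two 0%N 1%N u v; pose d0 := two 2 3 w z.
have c0E k : c0 k = two_digits 0 1 u v k :> nat by apply: twoE.
have d0E k : d0 k = two_digits 2 3 w z k :> nat by apply: twoE.
pose P (c : {ffun 'I_n -> 'I_q}) := (\sum_i c i <= m)%N.
have [n0 n1 n2] : [/\ 0 < n, 1 < n & 2 < n]%N by rewrite !(leq_trans _ n3).
have Pc0 : P c0 by rewrite /P; under eq_bigr do rewrite c0E; rewrite sum_two_digits ?uv.
have Pd0 : P d0 by rewrite /P; under eq_bigr do rewrite d0E; rewrite sum_two_digits ?wz.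
have unique c d : P c -> P d -> (W c + W d0 = W c0 + W d %[mod #|K|.-1])%N -> c = c0 /\ d = d0.
  move=> Pc Pd; rewrite /W -!big_split cardK /= => cd.
  pose nat_of (c : {ffun 'I_n -> 'I_q}) i := if insub i is Some j then c j : nat else 0%N.
  have nat_ofE c' (i : 'I_n) : nat_of c' i = c' i by rewrite /nat_of valK.
  have digits : forall i, (i < n)%N ->
      nat_of c i = two_digits 0 1 u v i /\ nat_of d i = two_digits 2 3 w z i.
    apply: (@digits_unique q n u v w z); rewrite ?ltnS ?uv ?wz //.
    - by under eq_bigr do rewrite nat_ofE.
    - by under eq_bigr do rewrite nat_ofE.
    rewrite (eq_bigr (fun i : 'I_n => c i * q ^ i + d0 i * q ^ i)%N) => [|i _]; last first.
      by rewrite nat_ofE d0E mulnDl.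
    rewrite cd; congr (_ %% _)%N; apply: eq_bigr => i _.
    by rewrite nat_ofE c0E mulnDl.
  split; apply/ffunP => i; apply/val_inj; rewrite /= -nat_ofE.
    by rewrite c0E; case: (digits i (ltn_ord i)).
  by rewrite d0E; case: (digits i (ltn_ord i)).
(* The weight [x ^+ W d0 / x ^+ W c0] extracts the coefficient of exponent [W c0 - W d0]; by
   [unique], only the pair [(c0, d0)] contributes to it. *)
have : \sum_(x : K | x != 0) (1 - (tr x - a) ^+ m) * (1 - (tr (alpha / x) - b) ^+ m)
    * (x ^+ W d0 / x ^+ W c0) = 0.
  apply: big1 => x x0; rewrite !zero_one //.
  by have := none x; rewrite x0 /= negb_and => /orP[] /negbTE ->; rewrite ?mul0r ?mulr0 ?mul0r.
have -> : \sum_(x : K | x != 0) (1 - (tr x - a) ^+ m) * (1 - (tr (alpha / x) - b) ^+ m)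
    * (x ^+ W d0 / x ^+ W c0) =
  \sum_(c | P c) \sum_(d | P d) ca c * (cb d * alpha ^+ W d) *
    \sum_(x : K | x != 0) x ^+ (W c + W d0) / x ^+ (W c0 + W d).
  under [RHS]eq_bigr do under eq_bigr do rewrite mulr_sumr.
  under [RHS]eq_bigr do rewrite exchange_big /=.
  rewrite exchange_big /=; apply: eq_bigr => x x0.
  rewrite caE cbE mulr_suml mulr_suml; apply: eq_bigr => c _.
  rewrite mulr_sumr mulr_suml; apply: eq_bigr => d _.
  rewrite expr_div_n !exprD invfM -/(W _) -/(W _); ring.
have term c d : P c -> P d -> (c, d) != (c0, d0) ->
    ca c * (cb d * alpha ^+ W d) *
      (\sum_(x : K | x != 0) x ^+ (W c + W d0) / x ^+ (W c0 + W d)) = 0.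
  move=> Pc Pd ne; rewrite finField_sum_expr_div; case: eqP => [cd|_].
    by have [cc dd] := unique c d Pc Pd cd; rewrite cc dd eqxx in ne.
  by rewrite oppr0 mulr0.
rewrite (bigD1 c0) //= [X in _ + X]big1 => [|c /andP[Pc cc0]]; last first.
  by apply: big1 => d Pd; apply: term; rewrite // xpair_eqE (negbTE cc0).
rewrite (bigD1 d0) //= [X in _ + X + _]big1 => [|d /andP[Pd dd0]]; last first.
  by apply: term; rewrite // xpair_eqE (negbTE dd0) andbF.
rewrite finField_sum_expr_div [(W c0 + _)%N]addnC addnC eqxx !addr0 => /eqP.
rewrite (ca0 (Ordinal n0) (Ordinal n1) u v) // (cb0 (Ordinal n2) (Ordinal n3) w z) //.
rewrite !mulf_eq0 !oppr_eq0 oner_eq0 orbF expf_eq0 (negbTE alpha0) andbF orbF.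
by apply/negP/norP; split; apply: (@bin_pred_neq0 _ q) => //; lia.
Qed.

Lemma finField_card_pnat (F : finFieldType) : [pchar F].-nat #|F|.
Proof.
have [p pp pF] := finPcharP F.
rewrite (eq_pnat _ (pcharf_eq pF)) -cardsT; exact: pprimeChar_pgroup.
Qed.

Theorem theorem5p1 (q n : nat) (F : finFieldType) (L : fieldExtType F)
    (card_F : #|F| = q) (dim_L : \dim {:L} = n)
    (hqn : (5 <= n)%N \/ (n = 4%N /\ (q = 2%N \/ q = 3%N)))
    (alpha : L) (alpha_neq0 : alpha != 0) (a b : F) :
  exists x y : L, [/\ Tr x = a%:A, Tr y = b%:A & alpha = x * y].
Proof.
pose K : finFieldType := finvect_type L.
have q1 : (1 < q)%N by rewrite -card_F finNzRing_gt1.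
have [m qm] : exists m, q = m.+1 by exists q.-1; rewrite prednK // ltnW.
have cardK : #|K| = (q ^ n)%N.
  by rewrite -card_F -dim_L -(card_vspace (fullv : {vspace K})); apply: eq_card => x; rewrite memvf.
have pK : [pchar K].-nat q.
  by rewrite -card_F (eq_pnat _ (pchar_lalg L : [pchar K] =i [pchar F])) finField_card_pnat.
have fixedA (c : F) : (c%:A : L) ^+ q = c%:A by rewrite -in_algE -rmorphXn -card_F /= expf_card.
rewrite qm in card_F cardK pK fixedA hqn.
have [u [v [w [z [uv wz [u0 w0 [wu wv zv vzn]]]]]]] : exists u v w z : nat,
    [/\ (u + v = m)%N, (w + z = m)%N & [/\ 0 < u, 0 < w &
     [/\ w <= u.+1, w <= v.+1, z <= v.+1 & v = 0 \/ (z <= u) /\ (4 < n)]]]%N.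
  (* For [n = 4] the last condition forces [v = 0], hence [w = 1] and [z <= 1]; as [w + z = q - 1],
     this is where [q] is restricted to 2 and 3. For larger [n] both pairs split [m] evenly. *)
  case: hqn => [n5|[_ [[m1]|[m2]]]].
  - by exists (uphalf m), m./2, (uphalf m), m./2;
      split; [lia | lia | split; [lia | lia | split; lia]].
  - by exists 1%N, 0%N, 1%N, 0%N; rewrite m1; split => //; split => //; split => //; left.
  - by exists 2%N, 0%N, 1%N, 1%N; rewrite m2; split => //; split => //; split => //; left.
have n3 : (3 < n)%N by case: hqn => [/ltnW //|[->]].
have [x [x0 xa xb]] := @inverse_traces K m n u v w z alpha _ _ pK cardK n3 uv wz u0 w0 wu wv zv vzn
  alpha_neq0 (fixedA a) (fixedA b).
exists x, (alpha / x); rewrite /Tr dim_L card_F; split=> //.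
by rewrite mulrCA divff ?mulr1.
Qed.
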